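(* Let $\{A,B,C\}$ be a non-degenerate hyperbolic or antipodal hyperbolic triangle with side lengths $a,b,c$ opposite $A,B,C$ and angles $\alpha,\beta,\gamma$ at $A,B,C$. Let $\{A',B',C'\}\subset S^{1,1}$ be its polar triangle, with side lengths $a',b',c'$ opposite $A',B',C'$ and angles $\alpha',\beta',\gamma'$ at $A',B',C'$. Then $$\alpha=\pi-a',\quad\beta=\pi-b',\quad\gamma=\pi-c';\qquad a=\alpha',\quad b=\beta',\quad c=\gamma'.$$
   Context: On $\mathbb{R}^3$ let $\langle\langle x,y\rangle\rangle=-x_1y_1+x_2y_2+x_3y_3$, $|||x|||=\sqrt{|\langle\langle x,x\rangle\rangle|}$, and let $\times$ be the Euclidean cross product. $H^2=\{x:\langle\langle x,x\rangle\rangle=-1,\ x_1>0\}$, $-H^2=\{-x:x\in H^2\}$, $S^{1,1}=\{x:\langle\langle x,x\rangle\rangle=1\}$. A hyperbolic (antipodal hyperbolic) triangle is a set of three distinct points in $H^2$ (in $-H^2$); it is non-degenerate if the three vertices are linearly independent. For $P,Q$ distinct, both in $H^2$ or both in $-H^2$: the side length is $\operatorname{arcosh}(-\langle\langle P,Q\rangle\rangle)$ and the tangent vector at $P$ towards $Q$ is $X_{PQ}=\frac{Q+\langle\langle P,Q\rangle\rangle P}{|||P\times Q|||}$; the angle at $P$ between the sides to $Q$ and $R$ is $\arccos(\langle\langle X_{PQ},X_{PR}\rangle\rangle)$. For $P,Q\in S^{1,1}$ with $P\neq\pm Q$ and $\operatorname{span}(P,Q)$ spacelike (i.e. $\langle\langle\cdot,\cdot\rangle\rangle$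 is positive definite on it): the side length is $\arccos(\langle\langle P,Q\rangle\rangle)$ and $X_{PQ}=\frac{Q-\langle\langle P,Q\rangle\rangle P}{|||P\times Q|||}$; the angle at $P$ between two such sides to $Q$ and $R$ is $\operatorname{arcosh}(|\langle\langle X_{PQ},X_{PR}\rangle\rangle|)$. The polar triangle of $\{A,B,C\}$ is $A'=\epsilon\frac{B\times C}{|||B\times C|||}$, $B'=\epsilon\frac{C\times A}{|||C\times A|||}$, $C'=\epsilon\frac{A\times B}{|||A\times B|||}$ with $\epsilon=\operatorname{sign}\det(A,B,C)$; for a non-degenerate (antipodal) hyperbolic triangle it lies in $S^{1,1}$ and all its sides are spacelike. *)

(* Defs.v *)
From mathcomp Require Import all_boot all_order all_algebra.
From mathcomp Require Import all_classical all_reals all_analysis.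
From mathcomp Require Import ring lra.

Set Implicit Arguments.
Unset Strict Implicit.
Unset Printing Implicit Defensive.

Import Order.TTheory GRing.Theory Num.Theory.
Local Open Scope classical_set_scope.
Local Open Scope ring_scope.

(* Meant for [1 <= x]; see [arcoshP]. *)
Definition arcosh (R : realType) (x : R) : R := ln (x + Num.sqrt (x ^+ 2 - 1)).

(* Vectors of R^3 are row vectors; the coordinates x_1, x_2, x_3 are
   [x 0 0], [x 0 1], [x 0 2]. *)

Definition ldot (R : realType) (x y : 'rV[R]_3) : R :=
  - (x 0 0 * y 0 0) + x 0 1 * y 0 1 + x 0 2%:R * y 0 2%:R.

Definition lnorm (R : realType) (x : 'rV[R]_3) : R := Num.sqrt `|ldot x x|.

(* The Euclidean cross product, not the Lorentzian one. *)
Definition cross (R : realType) (x y : 'rV[R]_3) : 'rV[R]_3 :=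
  \row_(i < 3) [:: x 0 1 * y 0 2%:R - x 0 2%:R * y 0 1;
                   x 0 2%:R * y 0 0 - x 0 0 * y 0 2%:R;
                   x 0 0 * y 0 1 - x 0 1 * y 0 0]`_i.

Definition det3 (R : realType) (x y z : 'rV[R]_3) : R :=
  \det (\matrix_(i < 3) [:: x; y; z]`_i).

Definition H2 (R : realType) : set 'rV[R]_3 :=
  [set x | ldot x x = -1 /\ 0 < x 0 0].

Definition negH2 (R : realType) : set 'rV[R]_3 := [set - x | x in @H2 R].

Definition S11 (R : realType) : set 'rV[R]_3 := [set x | ldot x x = 1].

Definition triangle_in (R : realType) (S : set 'rV[R]_3) (A B C : 'rV[R]_3) :=
  [/\ S A, S B & S C] /\ [/\ A <> B, B <> C & C <> A].

Definition hyperbolic_triangle (R : realType) (A B C : 'rV[R]_3) :=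
  triangle_in (@H2 R) A B C.

Definition antipodal_hyperbolic_triangle (R : realType) (A B C : 'rV[R]_3) :=
  triangle_in (@negH2 R) A B C.

Definition nondegenerate_triangle (R : realType) (A B C : 'rV[R]_3) : bool :=
  free [:: A; B; C].

(* The functions prefixed by [hyp_] are meant for distinct points P, Q, T that
   all lie in [H2] or all lie in [negH2]. *)

Definition hyp_length (R : realType) (P Q : 'rV[R]_3) : R :=
  arcosh (- ldot P Q).

Definition hyp_tangent (R : realType) (P Q : 'rV[R]_3) : 'rV[R]_3 :=
  (lnorm (cross P Q))^-1 *: (Q + ldot P Q *: P).

Definition hyp_angle (R : realType) (P Q T : 'rV[R]_3) : R :=
  acos (ldot (hyp_tangent P Q) (hyp_tangent P T)).

(* The functions prefixed by [sp_] are meant for points of [S11] joined by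
   spacelike sides; for polar triangles this is [polar_triangle_spacelike]. *)

Definition spacelike_side (R : realType) (P Q : 'rV[R]_3) :=
  [/\ S11 P, S11 Q, P <> Q, P <> - Q &
      forall v, v \in <<[:: P; Q]>>%VS -> v != 0 -> 0 < ldot v v].

Definition sp_length (R : realType) (P Q : 'rV[R]_3) : R := acos (ldot P Q).

Definition sp_tangent (R : realType) (P Q : 'rV[R]_3) : 'rV[R]_3 :=
  (lnorm (cross P Q))^-1 *: (Q - ldot P Q *: P).

Definition sp_angle (R : realType) (P Q T : 'rV[R]_3) : R :=
  arcosh `|ldot (sp_tangent P Q) (sp_tangent P T)|.

Definition polar_triangle (R : realType) (A B C : 'rV[R]_3) :
    'rV[R]_3 * 'rV[R]_3 * 'rV[R]_3 :=
  let eps := Num.sg (det3 A B C) in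
  (eps *: ((lnorm (cross B C))^-1 *: cross B C),
   eps *: ((lnorm (cross C A))^-1 *: cross C A),
   eps *: ((lnorm (cross A B))^-1 *: cross A B)).

Lemma arcoshP (R : realType) (x : R) : 1 <= x ->
  0 <= arcosh x /\ (expR (arcosh x) + expR (- arcosh x)) / 2 = x.
Proof.
move=> x1; rewrite /arcosh; set s := Num.sqrt _.
have s0 : 0 <= s by apply: sqrtr_ge0.
have s2 : s ^+ 2 = x ^+ 2 - 1 by rewrite sqr_sqrtr//; nra.
have p : 0 < x + s by lra.
split; first by rewrite ln_ge0//; lra.
rewrite expRN lnK ?posrE//.
have -> : (x + s)^-1 = x - s.
  apply: (mulfI (lt0r_neq0 p)); rewrite divff ?lt0r_neq0//.
  have -> : (x + s) * (x - s) = x ^+ 2 - s ^+ 2 by ring.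
  by rewrite s2; ring.
by field.
Qed.

Lemma det3E (R : realType) (x y z : 'rV[R]_3) :
  det3 x y z = x 0 0 * (y 0 1 * z 0 2%:R - y 0 2%:R * z 0 1)
             + x 0 1 * (y 0 2%:R * z 0 0 - y 0 0 * z 0 2%:R)
             + x 0 2%:R * (y 0 0 * z 0 1 - y 0 1 * z 0 0).
Proof.
have natE (w : 'rV[R]_3) : exists f : nat -> R, forall j, w 0 j = f (val j).
  by exists (fun k => w 0 (inord k)) => j; rewrite inord_val.
have [[f xE] [g yE] [h zE]] := And3 (natE x) (natE y) (natE z).
rewrite /det3 (expand_det_row _ ord0) !big_ord_recl big_ord0 /cofactor.
rewrite !(expand_det_row _ ord0) !big_ord_recl !big_ord0 /cofactor !det_mx11.
rewrite !mxE /= !xE !yE !zE /= /bump /=.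
by ring.
Qed.

Lemma crossE (R : realType) (x y : 'rV[R]_3) :
  [/\ cross x y 0 0 = x 0 1 * y 0 2%:R - x 0 2%:R * y 0 1,
      cross x y 0 1 = x 0 2%:R * y 0 0 - x 0 0 * y 0 2%:R &
      cross x y 0 2%:R = x 0 0 * y 0 1 - x 0 1 * y 0 0].
Proof. by rewrite /cross !mxE. Qed.

Lemma row3P (R : realType) (x y : 'rV[R]_3) :
  x 0 0 = y 0 0 -> x 0 1 = y 0 1 -> x 0 2%:R = y 0 2%:R -> x = y.
Proof.
move=> h0 h1 h2; apply/rowP => -[[|[|[|//]]] h].
- by rewrite (_ : Ordinal h = 0) //; apply: val_inj.
- by rewrite (_ : Ordinal h = 1) //; apply: val_inj.
- by rewrite (_ : Ordinal h = 2%:R) //; apply: val_inj.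
Qed.

Lemma det3_rot (R : realType) (x y z : 'rV[R]_3) : det3 y z x = det3 x y z.
Proof. by rewrite !det3E; ring. Qed.

Lemma ldot_cross (R : realType) (x y z w : 'rV[R]_3) :
  ldot (cross x y) (cross z w) = ldot x w * ldot y z - ldot x z * ldot y w.
Proof.
rewrite /ldot; have [-> -> ->] := crossE x y; have [-> -> ->] := crossE z w.
by ring.
Qed.

Lemma cross_cross (R : realType) (x y z : 'rV[R]_3) :
  cross (cross z x) (cross x y) = det3 x y z *: x.
Proof.
have [c0 c1 c2] := crossE (cross z x) (cross x y).
have [p0 p1 p2] := crossE z x; have [q0 q1 q2] := crossE x y.
by apply: row3P; rewrite ?c0 ?c1 ?c2 ?p0 ?p1 ?p2 ?q0 ?q1 ?q2 mxE det3E; ring.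
Qed.

Lemma nondegenerate_det3 (R : realType) (A B C : 'rV[R]_3) :
  nondegenerate_triangle A B C -> det3 A B C != 0.
Proof.
move=> /(@freeP _ _ _ [tuple A; B; C]) h; apply/negP => /det0P[v v0 vM].
case/negP: v0; apply/eqP/rowP => i; rewrite mxE; apply: (h (fun i => v 0 i)).
apply/rowP => j; move/rowP: vM => /(_ j); rewrite !mxE => <-.
by rewrite summxE; apply: eq_bigr => k _; rewrite !mxE.
Qed.

Lemma ldot_cross_gt0 (R : realType) (x y z : 'rV[R]_3) :
  ldot y y = -1 -> det3 x y z != 0 -> 0 < ldot (cross y z) (cross y z).
Proof.
move=> hy hd; set n := cross y z.
have [n0 n1 n2] := crossE y z.
have orth : n 0 0 * y 0 0 = - (n 0 1 * y 0 1 + n 0 2%:R * y 0 2%:R).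
  by rewrite /n n0 n1 n2; ring.
have dE : det3 x y z = x 0 0 * n 0 0 + x 0 1 * n 0 1 + x 0 2%:R * n 0 2%:R.
  by rewrite det3E /n n0 n1 n2.
move: hy; rewrite /ldot.
have : [|| n 0 0 != 0, n 0 1 != 0 | n 0 2%:R != 0].
  rewrite -!negb_and; apply: contra hd => /and3P[/eqP a /eqP b /eqP c].
  by rewrite dE a b c !mulr0 !addr0.
move: orth; clear.
move: (n 0 0) (n 0 1) (n 0 2%:R) (y 0 0) (y 0 1) (y 0 2%:R) => a b c p q r.
move=> orth nz hy.
have p2 : 1 <= p ^+ 2 by nra.
have p0 : 0 < p ^+ 2 by lra.
rewrite -(pmulr_rgt0 _ p0).
have -> : p ^+ 2 * (- (a * a) + b * b + c * c) =
          (b ^+ 2 + c ^+ 2) * p ^+ 2 - (a * p) ^+ 2 by ring.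
have -> : p ^+ 2 = 1 + q ^+ 2 + r ^+ 2 by nra.
rewrite orth.
have -> : (b ^+ 2 + c ^+ 2) * (1 + q ^+ 2 + r ^+ 2) - (- (b * q + c * r)) ^+ 2
          = b ^+ 2 + c ^+ 2 + (b * r - c * q) ^+ 2 by ring.
apply: ltr_wpDr; first exact: sqr_ge0.
rewrite lt_def addr_ge0 ?sqr_ge0// andbT paddr_eq0 ?sqr_ge0// !sqrf_eq0.
apply/negP => /andP[/eqP b0 /eqP c0]; move: nz orth p0.
rewrite b0 c0 eqxx /= orbF !mul0r addr0 oppr0 => a0 /eqP.
by rewrite mulf_eq0 (negbTE a0) /= => /eqP ->; rewrite expr0n ltxx.
Qed.

Lemma spacelike_sideP (R : realType) (P Q : 'rV[R]_3) :
  ldot P P = 1 -> ldot Q Q = 1 -> ldot P Q ^+ 2 < 1 -> spacelike_side P Q.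
Proof.
move=> hP hQ hPQ; split => //.
- by move=> e; move: hPQ; rewrite -e hP expr1n ltxx.
- move=> e; move: hPQ; rewrite e.
  have -> : ldot (- Q) Q = - ldot Q Q by rewrite /ldot !mxE; ring.
  by rewrite hQ sqrrN expr1n ltxx.
move=> v; rewrite span_cons span_seq1 => /memv_addP[_ /vlineP[s ->]].
move=> [_ /vlineP[t ->] ->] nz.
have -> : ldot (s *: P + t *: Q) (s *: P + t *: Q) =
    s ^+ 2 * ldot P P + 2 * s * t * ldot P Q + t ^+ 2 * ldot Q Q.
  by rewrite /ldot !mxE; ring.
rewrite hP hQ; set g := ldot P Q in hPQ *.
have -> : s ^+ 2 * 1 + 2 * s * t * g + t ^+ 2 * 1 =
          (s + t * g) ^+ 2 + t ^+ 2 * (1 - g ^+ 2) by ring.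
have [t0|t0] := eqVneq t 0.
  move: nz; rewrite t0 scale0r addr0 mul0r addr0 expr0n mul0r addr0 => nz.
  rewrite lt_def sqr_ge0 sqrf_eq0 andbT.
  by apply: contra nz => /eqP ->; rewrite scale0r.
apply: ltr_wpDl; first exact: sqr_ge0.
by rewrite mulr_gt0 ?subr_gt0// lt_def sqr_ge0 sqrf_eq0 t0.
Qed.

Lemma polar_side_spacelike (R : realType) (x y z : 'rV[R]_3) (e : R) :
  ldot x x = -1 -> ldot z z = -1 -> det3 x y z != 0 -> e ^+ 2 = 1 ->
  spacelike_side (e *: ((lnorm (cross z x))^-1 *: cross z x))
                 (e *: ((lnorm (cross x y))^-1 *: cross x y)).
Proof.
move=> hx hz hd he.
have p0 : 0 < ldot (cross z x) (cross z x).
  by apply: (@ldot_cross_gt0 _ y) => //; rewrite det3_rot.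
have q0 : 0 < ldot (cross x y) (cross x y).
  by apply: (@ldot_cross_gt0 _ z) => //; rewrite -det3_rot.
have N (w : 'rV[R]_3) : 0 < ldot w w ->
    (e * (lnorm w)^-1) ^+ 2 * ldot w w = 1.
  move=> w0; rewrite exprMn he mul1r exprVn /lnorm sqr_sqrtr ?normr_ge0//.
  by rewrite gtr0_norm// mulVf// gt_eqF.
have ldotZ k l (u v : 'rV[R]_3) : ldot (k *: u) (l *: v) = k * l * ldot u v.
  by rewrite /ldot !mxE; ring.
rewrite !scalerA; move: (N _ p0) (N _ q0).
set k := e / _; set l := e / _; set p := cross z x; set q := cross x y.
move=> Np Nq; apply: spacelike_sideP; rewrite ldotZ -?expr2 //.
rewrite -subr_gt0.
have -> : 1 - (k * l * ldot p q) ^+ 2 =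
    (k ^+ 2 * l ^+ 2) * (ldot p p * ldot q q - ldot p q ^+ 2).
  by rewrite -[1 in LHS]mulr1 -{1}Np -Nq; ring.
have -> : ldot p p * ldot q q - ldot p q ^+ 2 = det3 x y z ^+ 2.
  have := ldot_cross p q p q; rewrite cross_cross ldotZ hx.
  have -> : ldot q p = ldot p q by rewrite /ldot; ring.
  move=> h; rewrite -[RHS]opprK.
  have -> : - det3 x y z ^+ 2 = det3 x y z * det3 x y z * -1 by ring.
  by rewrite h; ring.
have nz (r t : R) : r ^+ 2 * t = 1 -> 0 < r ^+ 2.
  move=> h; rewrite lt_def sqr_ge0 andbT; apply/eqP => r0; move: h.
  by rewrite r0 mul0r => /esym/eqP; rewrite oner_eq0.
apply: mulr_gt0; first exact: mulr_gt0 (nz _ _ Np) (nz _ _ Nq).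
by rewrite lt_def sqr_ge0 sqrf_eq0 hd.
Qed.

Lemma polar_triangle_spacelike (R : realType) (A B C A' B' C' : 'rV[R]_3) :
  hyperbolic_triangle A B C \/ antipodal_hyperbolic_triangle A B C ->
  nondegenerate_triangle A B C -> polar_triangle A B C = (A', B', C') ->
  [/\ spacelike_side A' B', spacelike_side B' C' & spacelike_side C' A'].
Proof.
move=> hT /nondegenerate_det3 hd [<- <- <-].
have [hA hB hC] : [/\ ldot A A = -1, ldot B B = -1 & ldot C C = -1].
  have NE (x : 'rV[R]_3) : negH2 x -> ldot x x = -1.
    by move=> [u [hu _] <-]; rewrite -hu /ldot !mxE; ring.
  case: hT => -[[hA hB hC] _]; first by split; [case: hA|case: hB|case: hC].
  by split; apply: NE.
have he : Num.sg (det3 A B C) ^+ 2 = 1 by rewrite sqr_sg hd.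
split.
- by apply: (@polar_side_spacelike _ C A B); rewrite // -[det3 C A B]det3_rot.
- exact: (@polar_side_spacelike _ A B C).
- by apply: (@polar_side_spacelike _ B C A); rewrite // det3_rot.
Qed.

(* Main.v *)
(** For a vertex [x] of a triangle [x, y, z], the Binet-Cauchy formula
    [ldot_cross] turns the numerator of [ldot (hyp_tangent x y) (hyp_tangent x z)]
    into [- ldot (cross z x) (cross x y)], which gives the angles. Conversely
    [cross_cross] shows that the polar triangle of the polar triangle is the
    original one up to scaling, and the same formula gives the lengths. *)
Require Import Defs.
From mathcomp Require Import all_boot all_order all_algebra.
From mathcomp Require Import all_classical all_reals all_analysis.
From mathcomp Require Import ring lra.

Set Implicit Arguments.
Unset Strict Implicit.
Unset Printing Implicit Defensive.

Import Order.TTheory GRing.Theory Num.Theory.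
Local Open Scope classical_set_scope.
Local Open Scope ring_scope.

Lemma ldotZZ (R : realType) (k l : R) (x y : 'rV[R]_3) :
  ldot (k *: x) (l *: y) = k * l * ldot x y.
Proof. by rewrite /ldot !mxE; ring. Qed.

Lemma ldotNN (R : realType) (x y : 'rV[R]_3) : ldot (- x) (- y) = ldot x y.
Proof. by rewrite /ldot !mxE; ring. Qed.

Lemma ldotC (R : realType) (x y : 'rV[R]_3) : ldot x y = ldot y x.
Proof. by rewrite /ldot; ring. Qed.

Lemma crossZZ (R : realType) (k l : R) (x y : 'rV[R]_3) :
  cross (k *: x) (l *: y) = (k * l) *: cross x y.
Proof.
have [c0 c1 c2] := crossE (k *: x) (l *: y); have [p0 p1 p2] := crossE x y.
by apply: row3P; rewrite ?c0 ?c1 ?c2 !mxE ?p0 ?p1 ?p2 /=; ring.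
Qed.

Lemma crossNC (R : realType) (x y : 'rV[R]_3) : cross x y = -1 *: cross y x.
Proof.
have [c0 c1 c2] := crossE x y; have [p0 p1 p2] := crossE y x.
by apply: row3P; rewrite ?c0 ?c1 ?c2 mxE ?p0 ?p1 ?p2; ring.
Qed.

Lemma lnormZ (R : realType) (k : R) (x : 'rV[R]_3) :
  lnorm (k *: x) = `|k| * lnorm x.
Proof.
by rewrite /lnorm ldotZZ -expr2 normrM normrX sqrtrM ?exprn_ge0// sqrtr_sqr
  normr_id.
Qed.

Lemma lnorm_timelike (R : realType) (x : 'rV[R]_3) :
  ldot x x = -1 -> lnorm x = 1.
Proof. by move=> h; rewrite /lnorm h normrN1 sqrtr1. Qed.

(** Lets the norms in both tangent vectors at a vertex be written in the cyclic order used by the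
    polar triangle. *)
Lemma lnorm_crossC (R : realType) (x y : 'rV[R]_3) :
  lnorm (cross x y) = lnorm (cross y x).
Proof. by rewrite crossNC lnormZ normrN1 mul1r. Qed.

Lemma lnorm_gt0 (R : realType) (x : 'rV[R]_3) :
  0 < ldot x x -> 0 < lnorm x.
Proof. by move=> h; rewrite /lnorm sqrtr_gt0 normr_gt0 gt_eqF. Qed.

Lemma ldot_normalize (R : realType) (e : R) (x : 'rV[R]_3) :
  0 < ldot x x -> e ^+ 2 = 1 ->
  ldot (e *: ((lnorm x)^-1 *: x)) (e *: ((lnorm x)^-1 *: x)) = 1.
Proof.
move=> x0 he; rewrite !ldotZZ mulrA -expr2 he mul1r -expr2 exprVn.
by rewrite /lnorm sqr_sqrtr ?normr_ge0// gtr0_norm// mulVf// gt_eqF.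
Qed.

Lemma ldot_hyp_tangent (R : realType) (x y z : 'rV[R]_3) : ldot x x = -1 ->
  ldot (hyp_tangent x y) (hyp_tangent x z) =
  - ((lnorm (cross z x))^-1 * (lnorm (cross x y))^-1 *
     ldot (cross z x) (cross x y)).
Proof.
move=> hx; rewrite /hyp_tangent ldotZZ (lnorm_crossC x z) ldot_cross hx.
have -> : ldot (y + ldot x y *: x) (z + ldot x z *: x) =
    ldot y z + 2 * (ldot x y * ldot x z) + ldot x y * ldot x z * ldot x x.
  by rewrite /ldot !mxE; ring.
by rewrite hx (ldotC z x) (ldotC z y); ring.
Qed.

Lemma ldot_sp_tangent (R : realType) (x y z : 'rV[R]_3) : ldot x x = 1 ->
  ldot (sp_tangent x y) (sp_tangent x z) =
  (lnorm (cross x y))^-1 * (lnorm (cross z x))^-1 *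
  ldot (cross x y) (cross z x).
Proof.
move=> hx; rewrite /sp_tangent ldotZZ (lnorm_crossC x z) ldot_cross hx.
have -> : ldot (y - ldot x y *: x) (z - ldot x z *: x) =
    ldot y z - 2 * (ldot x y * ldot x z) + ldot x y * ldot x z * ldot x x.
  by rewrite /ldot !mxE; ring.
by rewrite hx (ldotC y x); ring.
Qed.

(** The minus sign in [ldot_hyp_tangent] turns into [pi -] through [acosN]. The sign [e] enters both
    polar vertices, so only its square survives. *)
Lemma hyp_angle_polar (R : realType) (x y z : 'rV[R]_3) (e : R) :
  ldot x x = -1 -> ldot y y = -1 -> ldot z z = -1 -> det3 x y z != 0 ->
  e ^+ 2 = 1 ->
  hyp_angle x y z =
  pi - sp_length (e *: ((lnorm (cross z x))^-1 *: cross z x))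
                 (e *: ((lnorm (cross x y))^-1 *: cross x y)).
Proof.
move=> hx hy hz hd he.
have hzx : 0 < ldot (cross z x) (cross z x).
  by apply: (@ldot_cross_gt0 _ y); rewrite // det3_rot.
have hxy : 0 < ldot (cross x y) (cross x y).
  by apply: (@ldot_cross_gt0 _ z); rewrite // -det3_rot.
rewrite /hyp_angle /sp_length ldot_hyp_tangent // !ldotZZ -expr2 he mul1r.
have p1 := ldot_normalize hzx he; have q1 := ldot_normalize hxy he.
rewrite acosN //.
(* [B' x C'] is a multiple of the timelike vertex, so the Gram determinant
   [1 - ldot B' C' ^+ 2] is nonnegative. *)
have := ldot_cross (e *: ((lnorm (cross z x))^-1 *: cross z x))
  (e *: ((lnorm (cross x y))^-1 *: cross x y))
  (e *: ((lnorm (cross z x))^-1 *: cross z x))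
  (e *: ((lnorm (cross x y))^-1 *: cross x y)).
rewrite p1 q1 !crossZZ cross_cross !ldotZZ hx -!expr2 he !mul1r.
rewrite (ldotC (cross x y)) -!mulrA.
move: (lnorm _)^-1 (lnorm _)^-1 (ldot _ _) => k l t h.
have : (k * (l * t)) ^+ 2 <= 1.
  have := sqr_ge0 (k * l * det3 x y z).
  by rewrite expr1n ?mul1r in h; lra.
by move=> ?; apply/andP; split; nra.
Qed.

(** By [cross_cross], the two cross products at the first polar vertex are multiples of [z] and [y],
    which have norm 1. The tangent product is thus [ldot y z] up to sign, and the absolute value in
    [sp_angle] returns [- ldot y z]. *)
Lemma hyp_length_polar (R : realType) (x y z : 'rV[R]_3) (e : R) :
  ldot x x = -1 -> ldot y y = -1 -> ldot z z = -1 -> det3 x y z != 0 ->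
  e ^+ 2 = 1 -> ldot y z <= 0 ->
  hyp_length y z =
  sp_angle (e *: ((lnorm (cross y z))^-1 *: cross y z))
           (e *: ((lnorm (cross z x))^-1 *: cross z x))
           (e *: ((lnorm (cross x y))^-1 *: cross x y)).
Proof.
move=> hx hy hz hd he hyz.
have hn (u v w : 'rV[R]_3) : ldot v v = -1 -> det3 u v w != 0 -> lnorm (cross v w) != 0.
  by move=> hv hd'; rewrite gt_eqF// lnorm_gt0// (ldot_cross_gt0 (x := u)).
have a0 : lnorm (cross y z) != 0 by apply: (hn x).
have b0 : lnorm (cross z x) != 0 by apply: (hn y); rewrite // det3_rot.
have c0 : lnorm (cross x y) != 0 by apply: (hn z); rewrite // -det3_rot.
have e0 : e != 0.
  by apply/eqP => e0; move/eqP: he; rewrite e0 expr0n eq_sym oner_eq0.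
rewrite /hyp_length /sp_angle; congr arcosh.
rewrite ldot_sp_tangent; last by apply: ldot_normalize (ldot_cross_gt0 hy hd) he.
rewrite !crossZZ !cross_cross !scalerA.
rewrite !lnormZ (lnorm_timelike hy) (lnorm_timelike hz) ldotZZ !mulr1.
rewrite -(ler0_norm hyz) (ldotC y z).
(* These are the scalar factors in front of [y] and [z]. Once shown nonzero, they cancel against
   their own absolute values. *)
set k := _ * det3 _ _ _; set l := _ * det3 _ _ _.
have hd1 : det3 z x y != 0 by rewrite -det3_rot.
have hd2 : det3 y z x != 0 by rewrite det3_rot.
have k0 : k != 0 by rewrite !mulf_neq0 ?invr_neq0.
have l0 : l != 0 by rewrite !mulf_neq0 ?invr_neq0.
move: k l k0 l0 => k l k0 l0; rewrite !(normrM, normfV, normr_id); field.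
by rewrite !normr_eq0 k0 l0.
Qed.

(** Cauchy-Schwarz on the last two coordinates: they contribute at most the product of the first
    coordinates, each of which exceeds the spatial norm. *)
Lemma ldot_H2_le0 (R : realType) (x y : 'rV[R]_3) :
  H2 x -> H2 y -> ldot x y <= 0.
Proof.
rewrite /H2 /= /ldot => -[].
move: (x 0 0) (x 0 1) (x 0 2%:R) (y 0 0) (y 0 1) (y 0 2%:R).
move=> a b c p q r hx a0 [hy p0].
have h : (b * q + c * r) ^+ 2 <= (a * p) ^+ 2.
  have -> : (a * p) ^+ 2 = (1 + (b ^+ 2 + c ^+ 2)) * (1 + (q ^+ 2 + r ^+ 2)).
    have -> : 1 + (b ^+ 2 + c ^+ 2) = a ^+ 2 by lra.
    have -> : 1 + (q ^+ 2 + r ^+ 2) = p ^+ 2 by lra.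
    by ring.
  (* Lagrange's identity: this square is the defect in Cauchy-Schwarz. *)
  have := sqr_ge0 (b * r - c * q).
  by move: (sqr_ge0 b) (sqr_ge0 c) (sqr_ge0 q) (sqr_ge0 r); nra.
have ap : 0 < a * p by apply: mulr_gt0.
have : b * q + c * r <= a * p.
  rewrite (le_trans (ler_norm _))// -(gtr0_norm ap).
  by rewrite -ler_sqr ?nnegrE// ?real_normK ?num_real.
lra.
Qed.

Lemma ldot_negH2_le0 (R : realType) (x y : 'rV[R]_3) :
  negH2 x -> negH2 y -> ldot x y <= 0.
Proof.
move=> [u hu <-] [v hv <-]; rewrite ldotNN; exact: ldot_H2_le0.
Qed.

Lemma ldot_negH2 (R : realType) (x : 'rV[R]_3) : negH2 x -> ldot x x = -1.
Proof. by move=> [u [hu _] <-]; rewrite ldotNN. Qed.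

Theorem lemma5p5 (R : realType) (A B C A' B' C' : 'rV[R]_3)
    (hT : hyperbolic_triangle A B C \/ antipodal_hyperbolic_triangle A B C)
    (hnd : nondegenerate_triangle A B C)
    (hpolar : polar_triangle A B C = (A', B', C')) :
  [/\ hyp_angle A B C = pi - sp_length B' C',
      hyp_angle B C A = pi - sp_length C' A' &
      hyp_angle C A B = pi - sp_length A' B'] /\
  [/\ hyp_length B C = sp_angle A' B' C',
      hyp_length C A = sp_angle B' C' A' &
      hyp_length A B = sp_angle C' A' B'].
Proof.
have hd := nondegenerate_det3 hnd.
(* Negating both arguments preserves [ldot], so the two kinds of triangle supply the same facts and
   are treated together from here on. *)
have [[hA hB hC] [hAB hBC hCA]] :
    [/\ ldot A A = -1, ldot B B = -1 & ldot C C = -1] /\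
    [/\ ldot A B <= 0, ldot B C <= 0 & ldot C A <= 0].
  case: hT => -[[hA hB hC] _].
    by split; [split; [case: hA|case: hB|case: hC]|split; apply: ldot_H2_le0].
  by split; split; (exact: ldot_negH2 || exact: ldot_negH2_le0).
have he : Num.sg (det3 A B C) ^+ 2 = 1 by rewrite sqr_sg hd.
have hd1 : det3 B C A != 0 by rewrite det3_rot.
have hd2 : det3 C A B != 0 by rewrite det3_rot.
case: hpolar => <- <- <-.
(* The six equalities are the instances of the two lemmas at the cyclic rotations of [A], [B], [C],
   with [e] the sign of the determinant. *)
by split; split; (exact: hyp_angle_polar || exact: hyp_length_polar).
Qed.
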